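(* Let $q$ be an even prime power, let $\mathcal{Q}$ be a quasi-quadric in $\mathrm{PG}(4,q)$, and let $\mathcal{H}$ be the set of solids of $\mathrm{PG}(4,q)$ that intersect $\mathcal{Q}$ in $(q+1)^2$ points. Then every point of $\mathrm{PG}(4,q)$ lies in either $0$, $\frac12 q^3$ or $\frac12(q^3+q^2)$ solids of $\mathcal{H}$. In particular, every quasi-quadric in $\mathrm{PG}(4,2)$ is a non-singular quadric.
   Context: A solid is a hyperplane of $\mathrm{PG}(4,q)$. Quasi-quadric means parabolic quasi-quadric: for $n=2m$ and $q$ even, a parabolic quasi-quadric with nucleus the point $N$ in $\mathrm{PG}(n,q)$ is a set $\mathcal{K}$ of $\frac{q^n-1}{q-1}$ points such that each line on $N$ contains a unique point of $\mathcal{K}$ and each hyperplane not on $N$ meets $\mathcal{K}$ in $\frac{(q^m+1)(q^{m-1}-1)}{q-1}$ or $\frac{(q^m-1)(q^{m-1}+1)}{q-1}$ points. For $n=4$ this means: $|\mathcal{K}|=q^3+q^2+q+1$, there is a point $N$ such that each line on $N$ contains a unique point of $\mathcal{K}$, and each solid not on $N$ meets $\mathcal{K}$ in $q^2+1$ or $(q+1)^2$ points. *)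

(* Defs.v *)
From HB Require Import structures.
From mathcomp Require Import all_boot all_algebra all_field.

Set Implicit Arguments.
Unset Strict Implicit.
Unset Printing Implicit Defensive.

Import GRing.Theory.
Local Open Scope ring_scope.

HB.instance Definition _ (F : finFieldType) (vT : vectType F) :=
  Countable.copy {vspace vT} (can_type (@VectorInternalTheory.vs2mxK F vT)).
HB.instance Definition _ (F : finFieldType) (vT : vectType F) :
    isFinite {vspace vT} := CanIsFinite (@VectorInternalTheory.vs2mxK F vT).

(* PG(n, q) is the lattice of subspaces of F^(n + 1), with q = #|F|. The index
   d of [flat] is the vector space dimension, i.e. one more than the projective
   dimension. *)
Definition flat (F : finFieldType) (n d : nat) :=
  {U : {vspace 'rV[F]_n.+1} | \dim U == d}.

HB.instance Definition _ (F : finFieldType) (n d : nat) :=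
  [isSub of flat F n d for @sval _ _].
HB.instance Definition _ (F : finFieldType) (n d : nat) :=
  [Finite of flat F n d by <:].

Notation point F n := (flat F n 1).
Notation line F n := (flat F n 2).
Notation hyperplane F n := (flat F n n).
Notation solid F := (hyperplane F 4).

Definition incident (F : finFieldType) (n d e : nat)
    (U : flat F n d) (W : flat F n e) : bool :=
  (val U <= val W)%VS.

Definition meet (F : finFieldType) (n d : nat)
    (K : {set point F n}) (U : flat F n d) : {set point F n} :=
  [set P in K | incident P U].

(* All the divisions below are exact when n = 2m with m > 0. *)
Definition quasi_quadric_with_nucleus (F : finFieldType) (n : nat)
    (N : point F n) (K : {set point F n}) : Prop :=
  let q := #|F| in
  let m := n./2 in
  [/\ ~~ odd n,
      #|K| = ((q ^ n - 1) %/ (q - 1))%N,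
      forall l : line F n, incident N l -> #|meet K l| = 1%N
    & forall S : hyperplane F n, ~~ incident N S ->
        #|meet K S| = ((q ^ m + 1) * (q ^ (m - 1) - 1) %/ (q - 1))%N \/
        #|meet K S| = ((q ^ m - 1) * (q ^ (m - 1) + 1) %/ (q - 1))%N].

Definition quasi_quadric (F : finFieldType) (n : nat)
    (K : {set point F n}) : Prop :=
  exists N : point F n, quasi_quadric_with_nucleus N K.

Definition large_solids (F : finFieldType) (K : {set point F 4}) :
    {set solid F} :=
  [set S : solid F | #|meet K S| == ((#|F| + 1) ^ 2)%N].

Definition qform (F : finFieldType) (n : nat) (A : 'M[F]_n.+1)
    (x : 'rV[F]_n.+1) : F :=
  \sum_(i < n.+1) \sum_(j < n.+1 | (i <= j)%N) A i j * x 0 i * x 0 j.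

Definition polar (F : finFieldType) (n : nat) (A : 'M[F]_n.+1)
    (x y : 'rV[F]_n.+1) : F :=
  qform A (x + y) - qform A x - qform A y.

Definition quadric (F : finFieldType) (n : nat) (A : 'M[F]_n.+1) :
    {set point F n} :=
  [set P : point F n | [forall x, (x \in val P) ==> (qform A x == 0)]].

(* A singular point <x> of the quadric is a point of it at which all partial
   derivatives of the form vanish; the derivative of the form at x in the
   direction y is [polar A x y]. The radical of the polar form may be nonzero
   (it is, for n even in characteristic 2), provided it has no point on the
   quadric. *)
Definition singular_vector (F : finFieldType) (n : nat) (A : 'M[F]_n.+1)
    (x : 'rV[F]_n.+1) : Prop :=
  [/\ x != 0, qform A x = 0 & forall y, polar A x y = 0].

Definition nonsingular_quadric (F : finFieldType) (n : nat)
    (K : {set point F n}) : Prop :=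
  exists2 A : 'M[F]_n.+1, K = quadric A & forall x, ~ singular_vector A x.

(* Main.v *)
Require Import Defs.
From mathcomp Require Import all_boot all_algebra all_field.
From mathcomp Require Import zify ring.

(** Everything rests on one double count. Let N be the nucleus and U a subspace
    of vector space dimension d that misses N. Counting the pairs (R, S) with R
    a point of Q and S a solid on both U and R but not on N, first over R and
    then over S, gives an equation for the number h(U) of large solids on U
    ([double_count_large]). Three facts feed it:
    - a subspace of dimension k that misses N lies in q ^ (4 - k) solids that
      miss N: normalised to be 1 on a vector of N, the linear functionals that
      define these solids are the solutions of an affine system of rank k + 1
      ([card_hyperplanes_avoiding]);
    - a subspace on N meets Q in as many points as it has lines on N, because Q
      has exactly one point on each of them ([card_trace_nucleus]); in
      particular a solid on N has q^2 + q + 1 points of Q and is not large;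
    - a point R of Q contributes q ^ (4 - d) if it lies in U, nothing if it lies
      in U + N but not in U, since then N lies in U + R, and q ^ (3 - d) if it
      lies outside U + N ([sum_meet_hyperplanes]).

    For U a point P other than N the equation reads
    2 h(P) = q^3 + [P in Q] q^2, while h(N) = 0: this is the first assertion.

    For U a plane it says that |Q meet U| = 2 h(U) + 1 is odd, and planes on N
    have q + 1 points of Q, which is odd as well for q even
    ([odd_trace_plane]). When q = 2 this says that the indicator function of the
    nonzero vectors off Q sums to zero over every three-dimensional subspace,
    that is, its third differences vanish. A function of this kind on a vector
    space over the field of two elements is a quadratic form
    ([quadratic_form_of_cubic_identity]), and Q is its quadric. A singular
    vector x would make that form invariant under translation by x; then the
    16 = 1 + 15 zeros of the form would be twice those in a solid that misses x
    and N, of which there are 1 + 5 or 1 + 9. *)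

Set Implicit Arguments.
Unset Strict Implicit.
Unset Printing Implicit Defensive.
Import GRing.Theory.

(** * Hyperplanes that avoid a point *)

Section Functionals.
Local Open Scope ring_scope.
Variable F : finFieldType.
Local Notation q := #|F|.

(** All fibres of a surjective linear map are translates of its kernel, hence
    equinumerous. *)
Lemma card_linear_system k n (M : 'M[F]_(k, n)) (b : 'cV_k) :
  row_free M -> #|[set a : 'cV[F]_n | M *m a == b]| = (q ^ (n - k))%N.
Proof.
move=> freeM; have [M' MM'] := row_freeP freeM.
have fibre c : #|[set a : 'cV[F]_n | M *m a == c]|
             = #|[set a : 'cV[F]_n | M *m a == 0]|.
  rewrite -(card_imset (mem [set a : 'cV[F]_n | M *m a == 0])
              (addrI (M' *m c))).
  apply: eq_card => a; rewrite inE; apply/eqP/imsetP => [Ma | [a0]].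
    exists (a - M' *m c); last by rewrite addrC subrK.
    by rewrite inE mulmxBr mulmxA MM' mul1mx Ma subrr.
  by rewrite inE => /eqP Ma0 ->; rewrite mulmxDr mulmxA MM' mul1mx Ma0 addr0.
have total : (q ^ k * #|[set a : 'cV[F]_n | M *m a == b]| = q ^ n)%N.
  have <- : #|{: 'cV[F]_n}| = (q ^ n)%N by rewrite card_mx muln1.
  rewrite -[RHS]sum1_card (partition_big (mulmx M) predT) //=.
  rewrite (eq_bigr (fun=> #|[set a : 'cV[F]_n | M *m a == b]|)).
    by rewrite sum_nat_const card_mx muln1.
  by move=> c _; rewrite fibre -(fibre c) sum1dep_card.
have q_gt0 : (0 < q)%N by apply/card_gt0P; exists 0.
have le_kn : (k <= n)%N by rewrite -(eqP freeM) rank_leq_col.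
apply/eqP; rewrite -(eqn_pmul2l (_ : 0 < q ^ k)%N) ?expn_gt0 ?q_gt0 //.
by rewrite total -expnD subnKC.
Qed.

(** The conditions form a linear system whose rows are [v] and a basis of [U];
    they are independent because [v] is not in [U]. *)
Lemma card_functionals n (U : {vspace 'rV[F]_n}) (v : 'rV[F]_n) :
    v \notin U ->
  #|[set a : 'cV[F]_n | (v *m a == 1) & [forall u in U, u *m a == 0]]|
    = (q ^ (n - (\dim U).+1))%N.
Proof.
move=> vU; pose X := [tuple of v :: vbasis U].
have freeX : free X.
  by rewrite free_cons (span_basis (vbasisP U)) vU (basis_free (vbasisP U)).
pose M := \matrix_(i < (\dim U).+1) X`_i.
have freeM : row_free M.
  apply: inj_row_free => c; rewrite mulmx_sum_row => cX.
  have /freeP/(_ (fun i => c 0 i)) c0 := freeX.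
  apply/rowP => i; rewrite [RHS]mxE c0 //.
  by rewrite -[RHS]cX; apply: eq_bigr => j _; rewrite rowK.
rewrite -(card_linear_system (delta_mx 0 0) freeM); apply: eq_card => a.
have rowM i : row i (M *m a) = X`_i *m a by rewrite row_mul rowK.
rewrite !inE; apply/andP/eqP => [[/eqP va /forall_inP Ua] | Ma].
  apply/row_matrixP => i; rewrite rowM.
  case: (unliftP 0 i) => [j ->|->] /=.
    have jU : (vbasis U)`_j \in U by rewrite vbasis_mem ?mem_nth ?size_tuple.
    rewrite (eqP (Ua _ jU)).
    by apply/rowP=> k; rewrite !mxE.
  by rewrite va; apply/rowP=> k; rewrite !mxE !ord1.
split.
  apply/eqP; have := rowM 0; rewrite Ma /= => <-.
  by apply/rowP=> k; rewrite !mxE !ord1.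
apply/forall_inP => u /coord_vbasis ->; apply/eqP.
rewrite mulmx_suml big1 // => i _; rewrite -scalemxAl.
have := rowM (lift 0 i); rewrite Ma /= => <-.
by apply/rowP=> k; rewrite !mxE /= mulr0.
Qed.

Definition functional_kernel n (a : 'cV[F]_n) : {vspace 'rV[F]_n} :=
  lker (linfun (mulmxr a)).

Lemma mem_functional_kernel n (a : 'cV[F]_n) x :
  (x \in functional_kernel a) = (x *m a == 0).
Proof. by rewrite memv_ker lfunE. Qed.

Lemma dim_add_line n (U : {vspace 'rV[F]_n}) v :
  v \notin U -> \dim (U + <[v]>) = (\dim U).+1.
Proof.
move=> vU; have v0 : v != 0 by apply: contraNneq vU => ->; rewrite mem0v.
rewrite dimv_disjoint_sum ?dim_vline ?v0 ?addn1 //.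
apply/eqP; rewrite -subv0; apply/subvP => x /memv_capP[xU /vlineP[c xv]].
rewrite memv0; apply: contraNT vU => x0.
have c0 : c != 0 by apply: contraNneq x0; rewrite xv => ->; rewrite scale0r.
by rewrite -(scalerK c0 v) -xv memvZ.
Qed.

Lemma hyperplane_add_line n (S : hyperplane F n) v :
  v \notin val S -> (val S + <[v]>)%VS = fullv.
Proof.
move=> vS; apply/eqP; rewrite eqEdim subvf dimvf /dim /= mul1n.
by rewrite dim_add_line // (eqP (valP S)).
Qed.

Lemma dim_functional_kernel n (a : 'cV[F]_n.+1) v :
  v *m a = 1 -> \dim (functional_kernel a) = n.
Proof.
move=> va; pose f : 'Hom('rV[F]_n.+1, 'rV[F]_1) := linfun (mulmxr a).
have imf : limg f = fullv.
  apply/eqP; rewrite eqEsubv subvf; apply/subvP => c _.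
  apply/memv_imgP; exists (c 0 0 *: v); rewrite ?memvf //.
  rewrite lfunE /= -scalemxAl va; apply/rowP => k.
  by rewrite !mxE !ord1 mulr1.
have := limg_ker_dim f fullv.
rewrite capfv imf !dimvf /dim /= !mul1n addn1 => /eqP.
by rewrite eqSS => /eqP.
Qed.

Definition mkflat n d (U : {vspace 'rV[F]_n.+1}) (dimU : \dim U == d) :
    flat F n d :=
  exist (fun W : {vspace 'rV[F]_n.+1} => \dim W == d) U dimU.

Lemma point_line n (P : point F n) : exists2 v, v != 0 & val P = <[v]>%VS.
Proof.
have P0 : vpick (val P) != 0 by rewrite vpick0 -dimv_eq0 (eqP (valP P)).
exists (vpick (val P)) => //; apply/esym/eqP.
by rewrite eqEdim -memvE memv_pick (eqP (valP P)) dim_vline P0.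
Qed.

(** A hyperplane off [N] is the kernel of exactly one functional that takes the
    value 1 on a fixed generator of [N]; this normalisation replaces the choice
    of a functional up to a scalar. *)
Lemma card_hyperplanes_avoiding n (U : {vspace 'rV[F]_n.+1}) (N : point F n) :
    ~~ (val N <= U)%VS ->
  #|[set S : hyperplane F n | (U <= val S)%VS && ~~ incident N S]|
    = (q ^ (n - \dim U))%N.
Proof.
have [v _ N0v] := point_line N; rewrite N0v -memvE => vU.
have kerN a : v *m a = 1 -> v \notin functional_kernel a.
  by move=> va; rewrite mem_functional_kernel va oner_eq0.
rewrite -[(n - _)%N]subSS -(card_functionals vU).
set A : {set 'cV[F]_n.+1} := [set a | (v *m a == 1) & _].
have AP a : reflect (v *m a = 1 /\ (U <= functional_kernel a)%VS) (a \in A).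
  rewrite inE; apply: (iffP andP) => [[/eqP va /forall_inP Ua] | [va Ua]].
    by split=> //; apply/subvP => u uU; rewrite mem_functional_kernel Ua.
  split; first by apply/eqP.
  by apply/forall_inP => u /(subvP Ua); rewrite mem_functional_kernel.
rewrite -(card_imset _ val_inj) -(card_in_imset (f := @functional_kernel n.+1)).
  apply: eq_card => S; apply/imsetP/imsetP => [[{}S SA ->] | [a aA ->]].
    move: SA; rewrite inE => /andP[US NS].
    have vS : v \notin val S by move: NS; rewrite /incident N0v -memvE.
    have [a] : exists a, a \in [set a : 'cV[F]_n.+1 |
        (v *m a == 1) & [forall u in val S, u *m a == 0]].
      apply/card_gt0P; rewrite card_functionals // expn_gt0.
      by apply/orP; left; apply/card_gt0P; exists 0.
    rewrite inE => /andP[/eqP va /forall_inP Sa].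
    have SKer : (val S <= functional_kernel a)%VS.
      by apply/subvP => u uS; rewrite mem_functional_kernel Sa.
    exists a; first by apply/AP; split=> //; apply: subv_trans SKer.
    by apply/eqP; rewrite eqEdim SKer (dim_functional_kernel va)
                       (eqP (valP S)) leqnn.
  have [va Ua] := AP _ aA.
  have dimKer : \dim (functional_kernel a) == n.
    by rewrite (dim_functional_kernel va).
  exists (mkflat dimKer) => //.
  by rewrite inE /= Ua /incident N0v -memvE kerN.
move=> a b /AP[va _] /AP[vb _] kerab.
(* The projection of [x] along [v] onto the common kernel determines both values
   at [x]. *)
apply/row_matrixP => i; rewrite !rowE; set x := delta_mx 0 i.
have : x - (x *m a) 0 0 *: v \in functional_kernel a.
  rewrite mem_functional_kernel mulmxBl -scalemxAl va subr_eq0.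
  by apply/eqP/rowP => k; rewrite !mxE !ord1 mulr1.
rewrite kerab mem_functional_kernel mulmxBl -scalemxAl vb subr_eq0 => /eqP ->.
by apply/rowP => k; rewrite !mxE !ord1 mulr1.
Qed.
End Functionals.

(** * Points of a subspace *)

Section Points.
Variables (F : finFieldType) (n : nat).
Local Notation q := #|F|.
Implicit Types (P R N X : point F n) (U W : {vspace 'rV[F]_n.+1}).

Lemma q_gt1 : 1 < q.
Proof. by have := card_finRing_gt1 F. Qed.

Lemma point_eq P v : v \in val P -> v != 0%R -> val P = <[v]>%VS.
Proof.
move=> vP v0; apply/esym/eqP.
by rewrite eqEdim -memvE vP (eqP (valP P)) dim_vline v0.
Qed.

Lemma point_sub_eq P R : (val P <= val R)%VS -> P = R.
Proof.
move=> PR; apply/val_inj/eqP.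
by rewrite eqEdim PR (eqP (valP P)) (eqP (valP R)).
Qed.

Lemma dim_add_point W P : ~~ (val P <= W)%VS -> \dim (W + val P) = (\dim W).+1.
Proof. by have [v _ ->] := point_line P; rewrite -memvE => /dim_add_line. Qed.

Lemma point_exchange W P R :
  ~~ (val P <= W)%VS -> (val P <= W + val R)%VS -> (val R <= W + val P)%VS.
Proof.
have [v v0 Pv] := point_line P; have [w w0 Rw] := point_line R.
rewrite Pv Rw -!memvE => vW /memv_addP[u uW [_ /vlineP[c ->] vuw]].
have c0 : c != 0%R by apply: contraNneq vW => c0; rewrite vuw c0 scale0r addr0.
rewrite -(scalerK c0 w) memvZ //.
have -> : (c *: w = - u + v)%R by rewrite vuw addKr.
by rewrite memv_add ?memvN ?memv_line.
Qed.

(** Every nonzero vector generates one point, and every point has q - 1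
    generators. *)
Lemma sum_nonzero_vectors U (f : 'rV[F]_n.+1 -> nat) (g : point F n -> nat) :
    (forall P v, v \in val P -> v != 0%R -> f v = g P) ->
  \sum_(v | (v \in U) && (v != 0%R)) f v
    = (q - 1) * \sum_(P | (val P <= U)%VS) g P.
Proof.
move=> fg; rewrite big_distrr /=.
have gP P : (q - 1) * g P = \sum_(v | (v \in val P) && (v != 0%R)) f v.
  rewrite (eq_bigr (fun=> g P)) => [|v /andP[vP v0]]; last exact: fg.
  rewrite sum_nat_const; congr (_ * _).
  have := card_vspace (val P); rewrite (eqP (valP P)) expn1 => <-.
  rewrite (cardD1 0%R) mem0v addKn.
  by apply: eq_card => v; rewrite !inE andbC.
under [RHS]eq_bigr do rewrite gP.
rewrite (exchange_big_dep (fun v => (v \in U) && (v != 0%R))) /=; last first.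
  by move=> P v PU /andP[vP ->]; rewrite (subvP PU).
apply: eq_bigr => v /andP[vU v0].
have dimv : \dim <[v]> == 1 by rewrite dim_vline v0.
rewrite (big_pred1 (mkflat dimv)) // => P.
apply/andP/eqP => [[PU /andP[vP _]] | ->].
  by apply: val_inj; rewrite (point_eq vP v0).
by rewrite /= -memvE vU memv_line.
Qed.

Lemma card_points U :
  #|[set P : point F n | (val P <= U)%VS]| = \sum_(i < \dim U) q ^ i.
Proof.
have := @sum_nonzero_vectors U (fun=> 1) (fun=> 1) (fun _ _ _ _ => erefl).
rewrite !sum1dep_card.
have -> : #|[set v | (v \in U) & v != 0%R]| = (q ^ \dim U).-1.
  rewrite -(card_vspace U) [in RHS](cardD1 0%R) mem0v.
  by apply: eq_card => v; rewrite !inE andbC.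
rewrite predn_exp -subn1 => /eqP; rewrite eqn_pmul2l ?subn_gt0 ?q_gt1 //.
by move=> /eqP ->.
Qed.
End Points.

(** * Sets with one point on each line on N *)

Section Nucleus.
Variables (F : finFieldType) (n : nat) (N : point F n) (K : {set point F n}).
Local Notation q := #|F|.
Implicit Types (P R X : point F n) (U W : {vspace 'rV[F]_n.+1}).
Hypothesis K_gt1 : 1 < #|K|.
Hypothesis K_section : forall l : line F n, incident N l -> #|meet K l| = 1.

Definition trace W : {set point F n} := [set R in K | (val R <= W)%VS].

Lemma trace_line X : X != N -> #|trace (val X + val N)| = 1.
Proof.
move=> XN.
have NX : ~~ (val N <= val X)%VS.
  by apply: contraNN XN => /point_sub_eq ->.
have dimXN : \dim (val X + val N) == 2.
  by rewrite dim_add_point // (eqP (valP X)).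
by rewrite -[RHS](K_section (l := mkflat dimXN)) // /incident addvSr.
Qed.

(** If [N] were in [K], a second point [R] of [K] would give the line [NR] two
    points of [K]. *)
Lemma nucleus_notin : N \notin K.
Proof.
apply/negP => NK.
have [R RK RN] : exists2 R, R \in K & R != N.
  have [x [y [xK yK xy]]] := card_gt1P K_gt1.
  have [xN | xN] := eqVneq x N; last by exists x.
  by exists y; rewrite // -xN eq_sym.
have := trace_line RN; apply/eqP; rewrite gtn_eqF //; apply/card_gt1P.
by exists R, N; rewrite !inE RK NK addvSl addvSr.
Qed.

Lemma neq_nucleus R : R \in K -> R != N.
Proof. by apply: contraTneq => ->; exact: nucleus_notin. Qed.

Lemma nucleus_nsub R : R \in K -> ~~ (val N <= val R)%VS.
Proof.
by move=> /neq_nucleus RN; apply: contraNN RN => /point_sub_eq ->.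
Qed.

(** Double count of the pairs (R, X) with R a point of [K] in [W] and X a point
    other than [N] on the line NR: each R lies in q of them and each X of
    [W] other than [N] in exactly one, as the line NX has a unique point of
    [K]. *)
Lemma card_trace_nucleus W :
  (val N <= W)%VS -> #|trace W| = \sum_(i < (\dim W).-1) q ^ i.
Proof.
move=> NW.
have dimW : \dim W = (\dim W).-1.+1.
  by rewrite prednK // (leq_trans _ (dimvS NW)) // (eqP (valP N)).
have pts U : (val N <= U)%VS ->
    (#|[set X | (val X <= U)%VS && (X != N)]|).+1 = \sum_(i < \dim U) q ^ i.
  move=> NU; rewrite -card_points [RHS](cardsD1 N) inE NU add1n; congr _.+1.
  by apply: eq_card => X; rewrite !inE andbC.
have double : #|trace W| * q = #|[set X | (val X <= W)%VS && (X != N)]|.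
  rewrite -sum1_card big_distrl -sum1dep_card /=.
  transitivity (\sum_(R in trace W)
      \sum_(X | (val X <= val R + val N)%VS && (X != N)) 1).
    apply: eq_bigr => R; rewrite inE => /andP[RK _]; rewrite mul1n.
    have := pts (val R + val N)%VS (addvSr _ _).
    rewrite dim_add_point ?nucleus_nsub // (eqP (valP R)) sum1dep_card.
    by rewrite !big_ord_recr big_ord0 /= => -[->].
  rewrite (exchange_big_dep (fun X => (val X <= W)%VS && (X != N))) /=.
    apply: eq_bigr => X /andP[XW XN]; rewrite sum1dep_card.
    rewrite -[RHS](trace_line XN).
    apply: eq_card => R; rewrite !inE XN andbT -andbA.
    case: (boolP (R \in K)) => //= RK; apply/andP/idP => [[_] | RX].
      rewrite addvC => XR; rewrite addvC; apply: point_exchange XR.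
      by apply: contraNN XN => /point_sub_eq ->.
    split; first by rewrite (subv_trans RX) // subv_add XW.
    rewrite addvC; apply: point_exchange; last by rewrite addvC.
    by apply: contraNN (neq_nucleus RK) => /point_sub_eq ->.
  move=> R X; rewrite inE => /andP[RK RW] /andP[XR ->].
  by rewrite (subv_trans XR) // subv_add RW.
apply/eqP; rewrite -(eqn_pmul2r (_ : 0 < q)) ?(ltnW (q_gt1 F)) // -eqSS.
rewrite double pts // dimW big_ord_recl /= big_distrl /= add1n eqSS.
by apply/eqP/eq_bigr => i _; rewrite -expnSr.
Qed.

(** Exchange the order of summation over hyperplanes and points R of [K].
    A hyperplane on [U] and R contains U + R, so it cannot avoid [N] when N lies
    in U + R; for R outside [U] this happens exactly when R lies in U + N. *)
Lemma sum_meet_hyperplanes U : ~~ (val N <= U)%VS ->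
  \sum_(S : hyperplane F n | (U <= val S)%VS && ~~ incident N S) #|meet K S|
    = #|trace U| * q ^ (n - \dim U)
      + #|K :\: trace (U + val N)| * q ^ (n - (\dim U).+1).
Proof.
move=> NU.
under eq_bigr do rewrite -sum1dep_card.
rewrite (exchange_big_dep (mem K)) /=; last by move=> S R _ /andP[].
have fibre R : R \in K ->
    \sum_(S : hyperplane F n | (U <= val S)%VS && ~~ incident N S
                               && ((R \in K) && incident R S)) 1
    = (R \in trace U) * q ^ (n - \dim U)
      + (R \in K :\: trace (U + val N)) * q ^ (n - (\dim U).+1).
  move=> RK; rewrite sum1dep_card !inE RK !andbT /=.
  have -> : #|[set S : hyperplane F n | (U <= val S)%VS && ~~ incident N S
                                        && incident R S]|
          = #|[set S : hyperplane F n | (U + val R <= val S)%VS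
                                        && ~~ incident N S]|.
    by apply: eq_card => S; rewrite !inE subv_add andbAC.
  case: (boolP (val R <= U)%VS) => RU.
    rewrite (addv_idPl RU) card_hyperplanes_avoiding //.
    by rewrite (subv_trans RU (addvSl _ _)) mul1n addn0.
  case: (boolP (val R <= U + val N)%VS) => RUN.
    rewrite add0n mul0n; apply/eqP; rewrite cards_eq0; apply/eqP/setP => S.
    rewrite !inE /incident; apply/negP => /andP[URS /negP]; apply.
    by apply: subv_trans URS; apply: point_exchange.
  rewrite card_hyperplanes_avoiding ?dim_add_point ?mul1n //.
  by apply: contraNN RUN; exact: point_exchange.
rewrite (eq_bigr _ fibre) big_split /= -!big_distrl /=.
by congr (_ * _ + _ * _); rewrite -sum1_card [RHS]big_mkcond [LHS]big_mkcond /=;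
  apply: eq_bigr => R _; rewrite !inE; case: (R \in K);
  rewrite ?andbF //=; case: ifP.
Qed.
End Nucleus.

(** * Large solids *)

Section QuasiQuadric.
Variables (F : finFieldType) (N : point F 4) (K : {set point F 4}).
Local Notation q := #|F|.
Implicit Types (P R : point F 4) (U W : {vspace 'rV[F]_5}) (S : solid F).
Hypothesis K_quasi : quasi_quadric_with_nucleus N K.

Lemma card_quasi_quadric : #|K| = \sum_(i < 4) q ^ i.
Proof.
case: K_quasi => _ -> _ _.
by rewrite subn1 predn_exp subn1 mulKn // -subn1 subn_gt0 q_gt1.
Qed.

Lemma quasi_quadric_gt1 : 1 < #|K|.
Proof.
rewrite card_quasi_quadric !big_ord_recr big_ord0 /= expn0 expn1.
by have := q_gt1 F; move: #|F| => x; nia.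
Qed.

Lemma quasi_quadric_section (l : line F 4) : incident N l -> #|meet K l| = 1.
Proof. by case: K_quasi => _ _ + _; apply. Qed.

Let card_trace := card_trace_nucleus quasi_quadric_gt1 quasi_quadric_section.

Lemma nucleus_notin_large S : S \in large_solids K -> ~~ incident N S.
Proof.
rewrite inE; apply: contraTN => NS.
have -> : meet K S = trace K (val S) by [].
rewrite card_trace // (eqP (valP S)) !big_ord_recr big_ord0 /=.
by have := q_gt1 F; move: #|F| => x; nia.
Qed.

Lemma card_meet_solid S : ~~ incident N S ->
  #|meet K S| = q ^ 2 + 1 + (S \in large_solids K) * (2 * q).
Proof.
move=> NS; case: K_quasi => _ _ _ /(_ S NS); rewrite inE /=.
have q1 : 0 < q - 1 by rewrite subn_gt0 q_gt1.
have -> : (q ^ 2 - 1) * (q ^ (2 - 1) + 1) = (q + 1) ^ 2 * (q - 1).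
  by rewrite -(exp1n 2) subn_sqr !exp1n expn1; ring.
rewrite expn1 !mulnK // => [][] ->; last by rewrite eqxx mul1n; ring.
have -> : (q ^ 2 + 1 == (q + 1) ^ 2) = false.
  by apply/eqP; have := q_gt1 F; move: #|F| => x; nia.
by rewrite mul0n addn0.
Qed.

Definition large_through U : {set solid F} :=
  [set S in large_solids K | (U <= val S)%VS].

(** The large solids exceed the small ones by (q + 1)^2 - (q^2 + 1) = 2q points,
    so the sum of |K meet S| over the solids on [U] off [N] determines their
    number. *)
Lemma double_count_large U : ~~ (val N <= U)%VS ->
  #|trace K U| * q ^ (4 - \dim U)
    + (\sum_(i < 4) q ^ i - \sum_(i < \dim U) q ^ i) * q ^ (4 - (\dim U).+1)
  = q ^ (4 - \dim U) * (q ^ 2 + 1) + 2 * q * #|large_through U|.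
Proof.
move=> NU; have := sum_meet_hyperplanes K NU; rewrite cardsD card_quasi_quadric.
have /setIidPr -> : trace K (U + val N) \subset K.
  by apply/subsetP => R; rewrite inE => /andP[].
rewrite (card_trace (addvSr U (val N))) dim_add_point //= => <-.
rewrite (eq_bigr _ (fun S h => card_meet_solid (proj2 (andP h)))) big_split /=.
rewrite sum_nat_const; congr (_ + _).
  rewrite -(card_hyperplanes_avoiding NU); congr (_ * _).
  by apply: eq_card => S; rewrite !inE.
rewrite -big_distrl /= mulnC; congr (_ * _).
rewrite -sum1_card big_mkcond [RHS]big_mkcond /=.
apply: eq_bigr => S _; rewrite [S \in large_through U]inE.
have [/nucleus_notin_large -> | _] := boolP (S \in large_solids K); last first.
  by case: ifP.
by rewrite andbT; case: ifP.
Qed.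

Lemma large_through_point P : P != N ->
  2 * #|large_through (val P)| = q ^ 3 + (P \in K) * q ^ 2.
Proof.
move=> PN.
have NP : ~~ (val N <= val P)%VS.
  by apply: contraNN PN => /point_sub_eq ->.
have := double_count_large NP; rewrite (eqP (valP P)).
have -> : #|trace K (val P)| = (P \in K).
  have [PK | PK] := boolP (P \in K).
    apply/eqP/cards1P; exists P; apply/setP => R; rewrite !inE.
    apply/andP/eqP => [[_ /point_sub_eq] | ->] //.
  apply/eqP; rewrite cards_eq0; apply/eqP/setP => R; rewrite !inE.
  by apply/negP => /andP[RK /point_sub_eq RP]; rewrite -RP RK in PK.
rewrite !big_ord_recl !big_ord0 /= !addn0 addKn => E.
apply/eqP; rewrite -(eqn_pmul2l (_ : 0 < q)) ?(ltnW (q_gt1 F)) //; apply/eqP.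
move: E;  move: #|F| #|large_through _| (nat_of_bool _) => x h b.
by rewrite /bump !subSS !subn0 !expnS !expn0; lia.
Qed.

Lemma large_through_nucleus : large_through (val N) = set0.
Proof.
apply/setP => S; rewrite !inE; apply/negP => /andP[SL].
by apply/negP/nucleus_notin_large; rewrite inE.
Qed.

(** Off the nucleus the double count gives the odd number 2 h + 1, where h
    is the number of large solids on the plane; on the nucleus it is q + 1,
    which is odd because q is even. *)
Lemma odd_trace_plane W : ~~ odd q -> \dim W = 3 -> odd #|trace K W|.
Proof.
move=> q_even dimW; case: (boolP (val N <= W)%VS) => NW.
  rewrite card_trace // dimW !big_ord_recr big_ord0 /=.
  by rewrite add0n expn1.
have := double_count_large NW; rewrite dimW.
rewrite !big_ord_recr !big_ord0 /= addKn => E.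
have : q * #|trace K W| = q * (2 * #|large_through W| + 1).
  move: E; move: #|F| #|trace _ _| #|large_through _| => x t h.
  by rewrite !subSS !subn0 !expnS !expn0; lia.
move=> /eqP; rewrite eqn_pmul2l ?(ltnW (q_gt1 F)) // => /eqP ->.
by rewrite addn1 /= mul2n odd_double.
Qed.
End QuasiQuadric.

(** * Quadratic forms from vanishing third differences *)

Section QuadraticExpansion.
Local Open Scope ring_scope.
Variables (V R : zmodType) (g : V -> R).
Hypothesis g0 : g 0 = 0.
Let B x y := g (x + y) - g x - g y.
Hypothesis BDr : forall x y z, B x (y + z) = B x y + B x z.

(** Split off the first vector; the polarisation of the two parts expands by
    additivity into the terms of the pairs that contain it. *)
Lemma quadratic_expansion n (v : 'I_n -> V) :
  g (\sum_i v i) = \sum_i (g (v i) + \sum_(j < n | (i < j)%N) B (v i) (v j)).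
Proof.
have B_sum x m (w : 'I_m -> V) : B x (\sum_i w i) = \sum_i B x (w i).
  elim: m w => [|m IHm] w; last by rewrite !big_ord_recl BDr IHm.
  by rewrite !big_ord0 /B addr0 g0 subr0 subrr.
elim: n v => [|n IHn] v; first by rewrite !big_ord0.
rewrite !big_ord_recl /= [X in _ + X + _]big_mkcond big_ord_recl /= add0r.
have -> : g (v ord0 + \sum_(i < n) v (lift ord0 i))
   = g (v ord0) + B (v ord0) (\sum_(i < n) v (lift ord0 i))
     + g (\sum_(i < n) v (lift ord0 i)).
  by rewrite /B addrA [g (v ord0) + _]addrC subrK subrK.
rewrite IHn B_sum; congr (_ + _).
by apply: eq_bigr => i _; congr (_ + _); rewrite [RHS]big_mkcond big_ord_recl
  /= add0r -big_mkcond.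
Qed.
End QuadraticExpansion.

Section FieldOfTwo.
Local Open Scope ring_scope.
Variables (F : finFieldType) (F2 : #|F| = 2).
Implicit Types c : F.

Lemma F2_cases c : c = 0 \/ c = 1.
Proof.
have [-> | c0] := eqVneq c 0; first by left.
have [-> | c1] := eqVneq c 1; first by right.
have := max_card (mem [set 0; 1; c]); rewrite F2 -setUA !cardsU1 cards1 !inE.
by rewrite eq_sym oner_eq0 eq_sym (negPf c0) eq_sym (negPf c1).
Qed.

Lemma addcc c : c + c = 0.
Proof.
have [E | /eqP] := F2_cases (1 + 1).
  by rewrite -(mulr1 c) -mulrDr E mulr0.
by rewrite -subr_eq0 addrK oner_eq0.
Qed.

Lemma oppc c : - c = c.
Proof. by apply/eqP; rewrite eq_sym -subr_eq0 opprK addcc. Qed.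

Lemma natr_addb (a b : bool) : (a (+) b)%:R = a%:R + b%:R :> F.
Proof. by case: a b => [][]; rewrite ?addr0 ?add0r ?addcc. Qed.

Variable n : nat.
Local Notation V := 'rV[F]_n.+1.
Implicit Types (x y z : V) (U : {vspace V}).

Lemma rowF2_addxx x : x + x = 0.
Proof. by apply/rowP => i; rewrite !mxE addcc. Qed.

Lemma sum_adjoin U z (f : V -> nat) : z \notin U ->
  (\sum_(v in (U + <[z]>)%VS) f v = \sum_(v in U) (f v + f (v + z)%R))%N.
Proof.
move=> zU; rewrite (bigID (mem U)) big_split /=; congr (_ + _)%N.
  apply: eq_bigl => v; apply/andP/idP => [[] // | vU].
  by rewrite (subvP (addvSl U _)).
rewrite (reindex_inj (addIr z)) /=; apply: eq_bigl => v.
apply/andP/idP => [[/memv_addP[u uU [_ /vlineP[c ->] vz]]] | vU].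
  case: (F2_cases c) vz => -> vz.
    by rewrite vz scale0r addr0 uU.
  by rewrite -[v](addrK z) vz scale1r addrK uU.
rewrite memv_add ?memv_line //; split=> //.
by apply: contraNN zU => vzU; rewrite -[z](addKr v) rpredD ?rpredN.
Qed.

(** The identity says that the polarisation B of [g] is additive. Scalars are
    only 0 and 1 here, so B is bilinear and [g] satisfies g (c v) = c^2 g v; the
    coefficients of the form are then the values of [g] and of B on the standard
    basis. *)
Lemma quadratic_form_of_cubic_identity (g : V -> F) :
    g 0 = 0 ->
    (forall x y z, g x + g y + g z + g (x + y) + g (x + z) + g (y + z)
                   + g (x + y + z) = 0) ->
  exists A : 'M[F]_n.+1, forall x, qform A x = g x.
Proof.
move=> g0 g3; pose B x y := g (x + y) - g x - g y.
have BDr x y z : B x (y + z) = B x y + B x z.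
  apply/eqP; rewrite -subr_eq0 /B !opprD !opprK !oppc !addrA -(g3 x y z).
  apply/eqP; rewrite -[RHS]addr0 -(addcc (g x)); ring.
pose e i : V := delta_mx 0 i.
pose A := \matrix_(i, j) if i == j then g (e i) else B (e i) (e j).
exists A => x; rewrite [in RHS](row_sum_delta x) (quadratic_expansion g0 BDr).
have gZ c v : g (c *: v) = g v * c * c.
  by case: (F2_cases c) => ->; rewrite ?scale0r ?g0 ?mulr0 ?scale1r ?mulr1.
have B0r y : B y 0 = 0 by rewrite /B addr0 g0 subr0 subrr.
have B0l y : B 0 y = 0 by rewrite /B add0r g0 subr0 subrr.
have BZ c d v w : B (c *: v) (d *: w) = B v w * c * d.
  by case: (F2_cases c) => ->; case: (F2_cases d) => ->;
    rewrite ?scale0r ?B0l ?B0r ?mulr0 ?mul0r ?scale1r ?mulr1.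
apply: eq_bigr => i _; rewrite (bigD1 i) //= mxE eqxx.
congr (_ + _); first by rewrite gZ.
apply: eq_big => [j | j /andP[_ ij]].
  by rewrite ltn_neqAle andbC eq_sym.
by rewrite -/(B (_ *: _) (_ *: _)) BZ mxE eq_sym (negPf ij).
Qed.
End FieldOfTwo.

(** * Quasi-quadrics over the field of two elements *)

Section BinaryQuasiQuadric.
Variables (F : finFieldType) (N : point F 4) (K : {set point F 4}).
Hypothesis K_quasi : quasi_quadric_with_nucleus N K.
Hypothesis F2 : #|F| = 2.
Local Notation V := 'rV[F]_5.
Implicit Types (P R : point F 4) (x y z v : V) (U : {vspace V}).

(** The vector 0 belongs to the cone, as it lies in every point: [cone] is thus
    the full zero set of the quadratic form to be found. *)
Definition cone v : bool := [exists R in K, v \in val R].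

Ltac case_cones :=
  repeat match goal with |- context [cone ?v] => case: (cone v) end.

Lemma coneP P v : v \in val P -> v != 0%R -> cone v = (P \in K).
Proof.
move=> vP v0; apply/exists_inP/idP => [[R RK vR] | PK]; last by exists P.
suff -> : P = R by [].
by apply: val_inj; rewrite (point_eq vP v0) (point_eq vR v0).
Qed.

Lemma cone0 : cone 0%R.
Proof.
have [R RK] : exists R, R \in K.
  by apply/card_gt0P; apply: ltnW (quasi_quadric_gt1 K_quasi).
by apply/exists_inP; exists R; rewrite ?mem0v.
Qed.

Lemma sum_cone U : \sum_(v in U) cone v = 1 + #|trace K U|.
Proof.
rewrite (bigD1 0%R) ?mem0v //= cone0; congr (_ + _).
rewrite (@sum_nonzero_vectors F 4 U cone (fun P => P \in K)); last first.
  by move=> P v vP v0; rewrite (coneP vP v0).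
rewrite F2 mul1n -sum1_card big_mkcond [RHS]big_mkcond /=.
by apply: eq_bigr => P _; rewrite inE andbC; case: (P \in K); case: ifP.
Qed.

(** For independent [x], [y], [z] the seven vectors are the points of a plane,
    which has an odd number of points in [K]. For dependent ones the vectors
    coincide in pairs, apart from one zero vector. *)
Lemma cone_cubic_identity x y z :
  cone x (+) cone y (+) cone z (+) cone (x + y)%R (+) cone (x + z)%R
    (+) cone (y + z)%R (+) cone (x + y + z)%R = true.
Proof.
have c0 := cone0; have addv v : (v + v = 0)%R := rowF2_addxx F2 v.
have addK v w : (v + (v + w) = w)%R by rewrite addrA addv add0r.
have mem_adjoin U v w : w \in (U + <[v]>)%VS -> w \in U \/ (w + v)%R \in U.
  move=> /memv_addP[u uU [_ /vlineP[c ->] ->]].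
  case: (F2_cases F2 c) => ->; first by left; rewrite scale0r addr0.
  by right; rewrite scale1r -addrA addv addr0.
have eq_of_add0 v w : (v + w = 0 -> v = w)%R.
  by move=> vw; rewrite -[w](addK v) vw addr0.
(* Subspaces are grown from 0 one generator at a time, so that independence is
   tested by membership and [sum_adjoin] expands the sum over their span. *)
have [x0 | x_n0] := boolP (x \in (0%VS : {vspace V})).
  rewrite (_ : x = 0%R) ?add0r ?c0; last by apply/eqP; rewrite -memv0.
  by case_cones.
have [yx | yx] := boolP (y \in (0%VS + <[x]>)%VS).
  case: (mem_adjoin _ _ _ yx); rewrite memv0 => /eqP.
    by move=> ->; rewrite !addr0 add0r c0; case_cones.
  by move=> /eq_of_add0 ->; rewrite addv add0r c0; case_cones.
have [zxy | zxy] := boolP (z \in (0%VS + <[x]> + <[y]>)%VS).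
  case: (mem_adjoin _ _ _ zxy) => /mem_adjoin[]; rewrite memv0 => /eqP.
  - by move=> ->; rewrite !addr0 c0; case_cones.
  - move=> /eq_of_add0 ->.
    rewrite addv [(y + x)%R]addrC [(x + y + x)%R]addrC addK c0.
    by case_cones.
  - by move=> /eq_of_add0 ->; rewrite -addrA addv addr0 c0; case_cones.
  rewrite -addrA => /eq_of_add0 ->.
  by rewrite [(y + x)%R]addrC addK addv addrCA addv addr0 c0; case_cones.
have dim3 : \dim (0%VS + <[x]> + <[y]> + <[z]>) = 3.
  by rewrite !dim_add_line // dimv0.
have F_even : ~~ odd #|F| by rewrite F2.
have := sum_cone (0%VS + <[x]> + <[y]> + <[z]>)%VS.
move=> /(congr1 odd); rewrite oddD (odd_trace_plane K_quasi) //.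
rewrite !(sum_adjoin F2) // (eq_bigl (pred1 0%R)) => [|v]; last first.
  by rewrite memv0.
rewrite big_pred1_eq /= !add0r !oddD !oddb c0.
by case_cones.
Qed.

(** If [x] is singular, the quadratic form is constant on the cosets of [x], so
    the solid [S] below, a complement of [x], contains half of its zeros; but
    neither 1 + 5 nor 1 + 9 is half of 16. *)
Lemma binary_quasi_quadric_nonsingular : nonsingular_quadric K.
Proof.
pose g v : F := ((~~ cone v)%:R)%R.
have [||A gA] := quadratic_form_of_cubic_identity F2 (g := g).
- by rewrite /g cone0.
- move=> x y z; rewrite /g -!(natr_addb F2).
  have := cone_cubic_identity x y z.
  by case_cones.
have g0 v : (g v == 0)%R = cone v.
  by rewrite /g; case: (cone v); rewrite ?eqxx ?oner_eq0.
exists A.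
  apply/setP => P; rewrite inE; apply/idP/forall_inP => [PK v vP | AP].
    by rewrite gA g0; apply/exists_inP; exists P.
  have [v v0 Pv] := point_line P.
  have vP : v \in val P by rewrite Pv memv_line.
  by rewrite -(coneP vP v0) -g0 -gA AP.
move=> x [x0 Ax polar_x].
have coneD v : cone (v + x)%R = cone v.
  have := polar_x v; rewrite /polar Ax !gA subr0 => /eqP.
  by rewrite subr_eq0 addrC -!g0 => /eqP ->.
have xK : cone x by rewrite -g0 -gA Ax.
have [v v0 Nv] := point_line N.
have xN : x \notin val N.
  apply/negP => xN; move: xK; rewrite (coneP xN x0); apply/negP.
  exact: nucleus_notin (quasi_quadric_gt1 K_quasi)
                       (quasi_quadric_section K_quasi).
have NU : ~~ (val N <= <[(x + v)%R]>)%VS.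
  rewrite Nv -memvE; apply: contraNN xN => vU.
  have -> : x = (x + v - v)%R by rewrite addrK.
  have dimNU : \dim <[(x + v)%R]> <= \dim (val N).
    by rewrite (eqP (valP N)) dim_vline leq_b1.
  have <- : <[(x + v)%R]>%VS = val N.
    by apply/esym/eqP; rewrite eqEdim dimNU Nv -memvE vU.
  by rewrite rpredB ?memv_line.
(* A solid on x + v that misses N = <v> also misses x. *)
have [S] : exists S, S \in [set S : solid F |
    (<[(x + v)%R]> <= val S)%VS && ~~ incident N S].
  by apply/card_gt0P; rewrite card_hyperplanes_avoiding // F2 expn_gt0.
rewrite inE -memvE => /andP[xvS NS].
have xS : x \notin val S.
  apply: contraNN NS => xS; rewrite /incident Nv -memvE.
  by rewrite -(addKr x v) rpredD ?rpredN.
have := sum_cone fullv.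
rewrite -(hyperplane_add_line xS) (sum_adjoin F2) //.
rewrite (eq_bigr (fun v => cone v + cone v)) => [|w _]; last by rewrite coneD.
rewrite big_split /= !sum_cone (hyperplane_add_line xS).
have -> : trace K fullv = K by apply/setP => R; rewrite inE subvf andbT.
have -> : #|trace K (val S)| = #|meet K S| by [].
rewrite (card_meet_solid K_quasi NS) (card_quasi_quadric K_quasi) F2.
by rewrite !big_ord_recr big_ord0 /=; case: (S \in _).
Qed.
End BinaryQuasiQuadric.

Theorem lemma1p7 (F : finFieldType) (q : nat) (card_F : #|F| = q)
    (q_even : ~~ odd q) (Q : {set point F 4}) (quasi_Q : quasi_quadric Q) :
  (forall P : point F 4,
      let h := #|[set S in large_solids Q | incident P S]| in
      [\/ h = 0, h = q ^ 3 %/ 2 | h = (q ^ 3 + q ^ 2) %/ 2]) /\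
  (q = 2 -> nonsingular_quadric Q).
Proof.
case: quasi_Q => N quasi_NQ; split=> [P h | q2]; last first.
  by apply: binary_quasi_quadric_nonsingular quasi_NQ _; rewrite card_F.
have h_def : h = #|large_through Q (val P)| by [].
have [PN | PN] := eqVneq P N.
  by constructor 1; rewrite h_def PN large_through_nucleus // cards0.
have := large_through_point quasi_NQ PN; rewrite card_F -h_def.
case: (P \in Q); rewrite ?mul0n ?mul1n ?addn0 => <-.
  by constructor 3; rewrite mulKn.
by constructor 2; rewrite mulKn.
Qed.
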